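(* Let $f\in C^2([0,1])$, let $u$ be the solution of the boundary value problem $-u''(x)=f(x)$ for $x\in(0,1)$, $u(0)=u(1)=0$, and let $u^{FD}=[u_1,u_2,\dots,u_{n-1}]^T$ be the finite difference solution, that is, the solution of $S\,u^{FD}=W\tilde f$. With $h_j=x_j-x_{j-1}$ for $j=1,\dots,n$ and $h:=\max_{1\le j\le n}|h_j|$, we have $$\max_{1\le j\le n-1}|u(x_j)-u_j|\le\frac{h^2}{48}\left(4\|f'\|_\infty+\|f''\|_\infty\right).$$
   Context: Let $n\ge 2$ and let $0=x_0<x_1<\cdots<x_n=1$ be arbitrary (possibly non-uniformly spaced) nodes. $S$ is the symmetric tridiagonal $(n-1)\times(n-1)$ matrix with entries $S_{jj}=\frac1{h_j}+\frac1{h_{j+1}}$ for $1\le j\le n-1$, $S_{j,j+1}=S_{j+1,j}=-\frac1{h_{j+1}}$ for $1\le j\le n-2$, and all other entries zero; $S$ is invertible. $W$ is the diagonal $(n-1)\times(n-1)$ matrix with $W_{jj}=\frac{h_j+h_{j+1}}2$, and $\tilde f=[f(x_1),\dots,f(x_{n-1})]^T$. For continuous $\theta$ on $[0,1]$, $\|\theta\|_\infty=\max_{x\in[0,1]}|\theta(x)|$. *)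

(* Defs.v *)
From HB Require Import structures.
From mathcomp Require Import all_boot all_order all_algebra.
From mathcomp Require Import all_classical all_reals all_analysis.
Set Implicit Arguments.
Unset Strict Implicit.
Unset Printing Implicit Defensive.
Import Order.TTheory GRing.Theory Num.Theory.
Import numFieldNormedType.Exports.
Local Open Scope classical_set_scope.
Local Open Scope ring_scope.

Definition diff_quot (R : realType) (g : R -> R) (x : R) : R -> R :=
  fun y => (g y - g x) / (y - x).

(* The derivative of g at x relative to the set A: only points of A are used,
   so on A = [0, 1] it is one-sided at 0 and at 1, and values of g off A are
   irrelevant. *)
Definition derivable_in (R : realType) (A : set R) (g : R -> R) : Prop :=
  forall x, A x -> cvg (diff_quot g x @ within A x^').

Definition derive_in (R : realType) (A : set R) (g : R -> R) : R -> R :=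
  fun x => lim (diff_quot g x @ within A x^').

Definition C2_in (R : realType) (A : set R) (g : R -> R) : Prop :=
  [/\ derivable_in A g,
      derivable_in A (derive_in A g) &
      {within A, continuous (derive_in A (derive_in A g))}].

Definition supnorm01 (R : realType) (g : R -> R) : R :=
  sup [set `|g t| | t in `[0, 1]].

(* For continuous g the supremum is the maximum. *)
Lemma supnorm01_max (R : realType) (g : R -> R) :
  {within `[0, 1], continuous g} ->
  exists2 c, c \in `[0, 1]%R &
    supnorm01 g = `|g c| /\ forall t, t \in `[0, 1]%R -> `|g t| <= `|g c|.
Proof.
move=> cg; have cng : {within `[(0 : R), 1], continuous (fun t => `|g t|)}.
  by move=> t; apply: cvg_norm; exact: cg.
have [c c01 cmax] := EVT_max ler01 cng.
exists c => //; split=> //; apply/eqP; rewrite eq_le; apply/andP; split.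
  by apply: ge_sup => [|_ [t t01 <-]]; [exists `|g c|, c | exact: cmax].
apply: ub_le_sup; last by exists c.
by exists `|g c| => _ [t t01 <-]; exact: cmax.
Qed.

(* Classical solution of -u'' = f on (0, 1), u(0) = u(1) = 0. *)
Definition bvp_solution (R : realType) (f u : R -> R) : Prop :=
  [/\ {within `[0, 1], continuous u},
      forall t : R, 0 < t < 1 ->
        [/\ derivable u t 1, derivable (derive1 u) t 1 &
            - derive1 (derive1 u) t = f t],
      u 0 = 0 & u 1 = 0].

(* Nodes are x 0, ..., x n; values of x beyond n are never used. *)
Definition is_mesh (R : realType) (n : nat) (x : nat -> R) : Prop :=
  [/\ x 0%N = 0, x n = 1 & forall j, (j < n)%N -> x j < x j.+1].

Definition step (R : realType) (x : nat -> R) (j : nat) : R :=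
  x j - x j.-1.

Definition mesh_width (R : realType) (n : nat) (x : nat -> R) : R :=
  \big[Num.max/0]_(1 <= j < n.+1) `|step x j|.

(* Row (or column) i : 'I_n.-1 stands for the interior node x_(i+1). *)
Definition stiffness (R : realType) (n : nat) (x : nat -> R) : 'M[R]_(n.-1) :=
  \matrix_(i < n.-1, k < n.-1)
    if k == i :> nat then (step x i.+1)^-1 + (step x i.+2)^-1
    else if k == i.+1 :> nat then - (step x i.+2)^-1
    else if i == k.+1 :> nat then - (step x k.+2)^-1
    else 0.

Definition mass (R : realType) (n : nat) (x : nat -> R) : 'M[R]_(n.-1) :=
  diag_mx (\row_(i < n.-1) ((step x i.+1 + step x i.+2) / 2)).

Definition node_values (R : realType) (n : nat) (x : nat -> R) (g : R -> R) :
  'cV[R]_(n.-1) := \col_(i < n.-1) g (x i.+1).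

(* Main.v *)
(** Let [z = x_i] be an interior node and [G] the Green function of [-d^2/dx^2]
    with pole [z].  It is affine on every mesh interval, so the discrete system
    represents [u_i] as the composite trapezoidal sum of [f G], whereas
    [u z] is the integral of [f G]: the nodal error is a trapezoidal quadrature
    error.  On an interval of length [d] that error is at most
    [d^3 / 12 * sup |(f G)''|], where [(f G)'' = f'' G + 2 f' G'], [|G| <= 1/4]
    and the total variation of [G] is [2 z (1 - z) <= 1/2].  No integral is
    needed: [u G' - u' G] is an explicit primitive of [f G] on each interval. *)
Require Import Defs.
From HB Require Import structures.
From mathcomp Require Import all_boot all_order all_algebra.
From mathcomp Require Import all_classical all_reals all_analysis.
From mathcomp Require Import ring lra.
Set Implicit Arguments.
Unset Strict Implicit.
Import Order.TTheory GRing.Theory Num.Theory.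
Import numFieldNormedType.Exports.
Local Open Scope classical_set_scope.
Local Open Scope ring_scope.

(** * Derivatives relative to a closed interval *)

(** Off [x], [g y] equals [g x + diff_quot g x y * (y - x)], which tends to [g x]; the filter is
    punctured, so [y = x] is handled separately at the end. *)
Lemma derivable_in_within_continuous (R : realType) (A : set R) (g : R -> R) :
  derivable_in A g -> {within A, continuous g}.
Proof.
move=> dg; apply/subspace_continuousP => x Ax.
have idA : id y @[y --> within A x^'] --> x.
  by move=> P /= [e e0 Pe]; exists e => // y ye _ _; exact: Pe.
have g_near : g y @[y --> within A x^'] --> g x.
  have -> : g x = g x + derive_in A g x * (x - x) by rewrite subrr mulr0 addr0.
  have : g x + diff_quot g x y * (y - x) @[y --> within A x^']
     --> g x + derive_in A g x * (x - x).
    apply: cvgD; first exact: cvg_cst.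
    apply: cvgM; first exact: dg.
    by apply: cvgB; [exact: idA | exact: cvg_cst].
  apply: cvg_trans; apply: near_eq_cvg; exists 1 => //= y _ yx _.
  by rewrite /diff_quot divfK ?subr_eq0// addrC subrK.
move=> P Pgx; have [e e0 Pe] := g_near _ Pgx; exists e => // y ye Ay.
have [->|yx] := eqVneq y x; first exact: (nbhs_singleton Pgx).
exact: Pe.
Qed.

(** Around an interior point, small increments stay in [[a, b]], so the relative difference quotient
    has the ordinary two-sided limit. *)
Lemma derivable_in_is_derive (R : realType) (a b t : R) (g : R -> R) :
  derivable_in `[a, b] g -> a < t < b ->
  is_derive t (1 : R) g (derive_in `[a, b] g t).
Proof.
move=> dg /andP[at_ tb].
have shift_cvg : h + t @[h --> 0^'] --> within `[a, b] (t^').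
  move=> P [e /= e0 Pe].
  exists (Num.min e (Num.min (t - a) (b - t))) => /=.
    by rewrite !lt_min e0 !subr_gt0 at_ tb.
  move=> h /=; rewrite sub0r normrN !lt_min => /and3P[he hta hbt] h0.
  apply: Pe => /=.
  - by rewrite opprD addrCA subrr addr0 normrN.
  - by rewrite -subr_eq0 addrK.
  - rewrite in_itv/=; move: hta hbt; rewrite !ltr_norml => /andP[h1 _] /andP[_ h2].
    by apply/andP; split; lra.
have quot : h^-1 *: ((g \o shift t) (h *: 1) - g t) @[h --> 0^'] -->
    derive_in `[a, b] g t.
  have tab : `[a, b]%classic t by rewrite /= in_itv/= !ltW.
  have := cvg_comp _ _ shift_cvg (dg t tab); apply: cvg_trans.
  apply: near_eq_cvg; near=> h.
  by rewrite /= /diff_quot addrK mulrC [h *: 1]mulr1.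
by apply: DeriveDef; [apply/cvg_ex; eexists; exact: quot | exact: cvg_lim quot].
Unshelve. all: by end_near. Qed.

(** * Error of the trapezoidal rule on one interval *)

(** Replaces integrating [|F'| <= K']: both [K - F] and [K + F] have nonnegative derivative, so the
    mean value theorem makes their increments nonnegative. *)
Lemma le_norm_increment (R : realType) (a b : R) (F F' K K' : R -> R) :
  a <= b ->
  {within `[a, b], continuous F} -> {within `[a, b], continuous K} ->
  (forall t, t \in `]a, b[ -> is_derive t (1 : R) F (F' t)) ->
  (forall t, t \in `]a, b[ -> is_derive t (1 : R) K (K' t)) ->
  (forall t, t \in `]a, b[ -> `|F' t| <= K' t) ->
  `|F b - F a| <= K b - K a.
Proof.
rewrite le_eqVlt => /predU1P[->|ab] cF cK dF dK FK; first by rewrite !subrr normr0.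
have dKF t : t \in `]a, b[ -> is_derive t (1 : R) (K - F) (K' t - F' t).
  by move=> tab; apply: is_deriveB; [exact: dK | exact: dF].
have dKF' t : t \in `]a, b[ -> is_derive t (1 : R) (K + F) (K' t + F' t).
  by move=> tab; apply: is_deriveD; [exact: dK | exact: dF].
have [c cab Bc] := MVT ab dKF (within_continuousB cK cF).
have [d dab Dd] := MVT ab dKF' (within_continuousD cK cF).
have ba0 : 0 <= b - a by rewrite subr_ge0 ltW.
have {}Bc : 0 <= (K - F) b - (K - F) a.
  rewrite Bc mulr_ge0// subr_ge0; exact: le_trans (ler_norm _) (FK _ cab).
have {}Dd : 0 <= (K + F) b - (K + F) a.
  rewrite Dd mulr_ge0//; have := FK _ dab; rewrite ler_norml => /andP[+ _]; lra.
have KFE t : ((K - F) t = K t - F t) /\ (K + F) t = K t + F t by [].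
rewrite !(KFE _).1 !(KFE _).2 in Bc Dd.
by rewrite ler_norml; apply/andP; split; lra.
Qed.

Lemma within_continuousM (R : realType) (A : set R) (f g : R -> R) :
  {within A, continuous f} -> {within A, continuous g} ->
  {within A, continuous (f * g)}.
Proof.
move=> /subspace_continuousP cf /subspace_continuousP cg.
by apply/subspace_continuousP => t At; apply: cvgM; [exact: cf | exact: cg].
Qed.

Lemma is_derive_continuous (R : realType) (A : set R) (f f' : R -> R) :
  (forall t, is_derive t (1 : R) f (f' t)) -> {within A, continuous f}.
Proof.
move=> df; apply: continuous_subspaceT => t.
exact/differentiable_continuous/derivable1_diffP.
Qed.

(** Let the right endpoint vary: [E t] is the error on [[a, t]]. Then [E] and [E'] vanish at [a] and
    [E'' = - (t - a) / 2 * g'']. Two applications of [le_norm_increment] lift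
    [|E''| <= M / 2 * (t - a)] to [E'], then to [E]; the majorants are [K''], [K'] and [K]. *)
Lemma trapezoid_error (R : realType) (a b M : R) (G g g' g'' : R -> R) :
  a <= b ->
  {within `[a, b], continuous G} -> {within `[a, b], continuous g} ->
  {within `[a, b], continuous g'} ->
  (forall t, t \in `]a, b[ -> is_derive t (1 : R) G (g t)) ->
  (forall t, t \in `]a, b[ -> is_derive t (1 : R) g (g' t)) ->
  (forall t, t \in `]a, b[ -> is_derive t (1 : R) g' (g'' t)) ->
  (forall t, t \in `]a, b[ -> `|g'' t| <= M) ->
  `|G b - G a - (b - a) / 2 * (g a + g b)| <= M / 12 * (b - a) ^+ 3.
Proof.
move=> ab cG cg cg' dG dg dg' gM.
pose D : R -> R := id - cst a.
have dD t : is_derive t (1 : R) D 1.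
  by apply: is_derive_eq; rewrite subr0.
have cD (A : set R) : {within A, continuous D} by apply: is_derive_continuous dD.
have cc (A : set R) (c : R) : {within A, continuous (cst c : R -> R)}.
  by apply: (@is_derive_continuous _ _ _ (cst 0)) => t; exact: is_derive_cst.
pose E' : R -> R := cst (1 / 2) * (g - cst (g a)) - cst (1 / 2) * D * g'.
pose K' : R -> R := cst (M / 4) * D ^+ 2.
pose K'' : R -> R := cst (M / 2) * D.
pose E : R -> R := G - cst (G a) - cst (1 / 2) * D * (cst (g a) + g).
pose K : R -> R := cst (M / 12) * D ^+ 3.
have dK' t : is_derive t (1 : R) K' (K'' t).
  by apply: is_derive_eq; rewrite /K'' /D /GRing.scale !fctE/=; field.
have dK t : is_derive t (1 : R) K (K' t).
  by apply: is_derive_eq; rewrite /K' /D /GRing.scale !fctE/=; field.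
have cE' : {within `[a, b], continuous E'}.
  exact: within_continuousB
    (within_continuousM (cc _ _) (within_continuousB cg (cc _ _)))
    (within_continuousM (within_continuousM (cc _ _) (cD _)) cg').
have cE : {within `[a, b], continuous E}.
  exact: within_continuousB (within_continuousB cG (cc _ _))
    (within_continuousM (within_continuousM (cc _ _) (cD _))
       (within_continuousD (cc _ _) cg)).
have dE' t : t \in `]a, b[ -> is_derive t (1 : R) E' (- (1 / 2 * D t * g'' t)).
  move=> tab; have := dg t tab; have := dg' t tab => ? ?.
  by apply: is_derive_eq; rewrite /D /GRing.scale !fctE/=; field.
have dE t : t \in `]a, b[ -> is_derive t (1 : R) E (E' t).
  move=> tab; have := dg t tab; have := dG t tab => ? ?.
  by apply: is_derive_eq; rewrite /E' /D /GRing.scale !fctE/=; field.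
have D0 t : t \in `]a, b[ -> 0 <= D t.
  by rewrite in_itv/= => /andP[/ltW + _]; rewrite -subr_ge0.
have boundE' t : t \in `]a, b[ -> `|E' t| <= K' t.
  move=> tab; have /andP[at_ tb] : a < t < b by rewrite in_itv in tab.
  have sub : `[a, t] `<=` `[a, b].
    by move=> y /=; rewrite !in_itv/= => /andP[-> yt]; exact: le_trans (ltW tb).
  have sub' y : y \in `]a, t[ -> y \in `]a, b[.
    by rewrite !in_itv/= => /andP[-> yt]; exact: lt_trans tb.
  have -> : E' t = E' t - E' a.
    by rewrite [E' a](_ : _ = 0) ?subr0// /E' /D !fctE/=; ring.
  have -> : K' t = K' t - K' a.
    by rewrite [K' a](_ : _ = 0) ?subr0// /K' /D !fctE/=; ring.
  apply: (le_norm_increment (ltW at_) (continuous_subspaceW sub cE')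
    (is_derive_continuous dK') (fun y yat => dE' y (sub' _ yat))
    (fun y _ => dK' y)).
  move=> y /sub' yab; have D2 : 0 <= 1 / 2 * D y by rewrite mulr_ge0 ?D0//; lra.
  rewrite normrN normrM (ger0_norm D2).
  have -> : K'' y = 1 / 2 * D y * M by rewrite /K'' /D !fctE/=; field.
  by rewrite ler_wpM2l ?gM.
have EE : E b - E a = G b - G a - (b - a) / 2 * (g a + g b).
  by rewrite /E /D !fctE/=; field.
have KE : K b - K a = M / 12 * (b - a) ^+ 3 by rewrite /K /D !fctE/=; ring.
rewrite -EE -KE; exact: (le_norm_increment ab cE (is_derive_continuous dK) dE
  (fun y _ => dK y) boundE').
Qed.

(** * The boundary value problem on one mesh interval *)

Lemma supnorm01_ge (R : realType) (g : R -> R) (t : R) :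
  {within `[0, 1], continuous g} -> 0 <= t <= 1 -> `|g t| <= supnorm01 g.
Proof.
by move=> /supnorm01_max[c _ [-> gc]] t01; apply: gc; rewrite in_itv.
Qed.

Lemma bvp_solution_is_derive (R : realType) (f u : R -> R) (t : R) :
  bvp_solution f u -> 0 < t < 1 ->
  is_derive t (1 : R) u (derive1 u t) /\ is_derive t (1 : R) (derive1 u) (- f t).
Proof.
move=> [_ + _ _] t01 => /(_ t t01)[du ddu <-].
by rewrite opprK !derive1E; split; exact: derivableP.
Qed.

(** Since [u'' = - f] is bounded, [u'] is Lipschitz on the open interval; comparing with its value
    at the midpoint bounds it. *)
Lemma bvp_solution_derive1_bounded (R : realType) (f u : R -> R) :
  {within `[0, 1], continuous f} -> bvp_solution f u ->
  exists C : R, forall t, 0 < t < 1 -> `|derive1 u t| <= C.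
Proof.
move=> cf sol; pose K : R -> R := cst (supnorm01 f) * id.
have dK t : is_derive t (1 : R) K (supnorm01 f).
  by apply: is_derive_eq; rewrite /GRing.scale !fctE/= mulr0 addr0 mulr1.
have lip c d : 0 < c -> c <= d -> d < 1 ->
    `|derive1 u d - derive1 u c| <= supnorm01 f * (d - c).
  move=> c0 cd d1.
  have in01 t : t \in `[c, d] -> 0 < t < 1.
    rewrite in_itv/= => /andP[ct td].
    by rewrite (lt_le_trans c0)//= (le_lt_trans td).
  have ino01 t : t \in `]c, d[ -> 0 < t < 1.
    by move=> /subset_itv_oo_cc; exact: in01.
  rewrite mulrBr; apply: (@le_norm_increment _ _ _ _ (- f) K (cst (supnorm01 f))) => //.
  - apply: derivable_within_continuous => t /in01 t01.
    by have [_ []] := bvp_solution_is_derive sol t01.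
  - exact: is_derive_continuous dK.
  - by move=> t /ino01 t01; have [] := bvp_solution_is_derive sol t01.
  - move=> t /ino01/andP[t0 t1]; rewrite normrN supnorm01_ge//.
    by rewrite !ltW.
have F0 : 0 <= supnorm01 f.
  by rewrite (le_trans (normr_ge0 (f 0)))// supnorm01_ge// lexx ler01.
exists (`|derive1 u (1 / 2)| + supnorm01 f) => t /andP[t0 t1].
have -> : derive1 u t = derive1 u (1 / 2) + (derive1 u t - derive1 u (1 / 2)) by ring.
rewrite (le_trans (ler_normD _ _))// lerD2l.
have h0 : 0 < 1 / 2 :> R by lra.
have h1 : 1 / 2 < 1 :> R by lra.
have [ht|th] := leP (1 / 2) t.
  by apply: (le_trans (lip _ _ h0 ht t1)); rewrite ler_piMr//; lra.
rewrite distrC; apply: (le_trans (lip _ _ t0 (ltW th) h1)).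
by rewrite ler_piMr//; lra.
Qed.

(* derive1 u is junk at 0 and 1; there, continuity of the product comes from the
   vanishing of L and the boundedness of u' inside. *)
Lemma bvp_solution_derive1M_continuous (R : realType) (f u L : R -> R)
    (a b : R) :
  {within `[0, 1], continuous f} -> bvp_solution f u ->
  continuous L -> 0 <= a -> b <= 1 ->
  (a = 0 -> L a = 0) -> (b = 1 -> L b = 0) ->
  {within `[a, b], continuous (derive1 u * L)}.
Proof.
move=> cf sol cL a0 b1 La Lb; have [C uC] := bvp_solution_derive1_bounded cf sol.
apply/subspace_continuousP => t; rewrite /= in_itv/= => /andP[at_ tb].
have end_zero y : a <= y <= b -> ~~ (0 < y < 1) -> L y = 0.
  move=> /andP[ay yb]; rewrite negb_and -!leNgt => /orP[y0|y1].
    have ya : y = a by apply/eqP; rewrite eq_le ay (le_trans y0 a0).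
    by rewrite ya La//; apply/eqP; rewrite eq_le a0 -ya y0.
  have yb' : y = b by apply/eqP; rewrite eq_le yb (le_trans b1 y1).
  by rewrite yb' Lb//; apply/eqP; rewrite eq_le b1 -yb' y1.
have [t01|t01] := boolP (0 < t < 1).
  have [_ du'] := bvp_solution_is_derive sol t01.
  apply: cvg_within_filter; apply: cvgM; last exact: cL.
  exact/differentiable_continuous/derivable1_diffP.
have Lt0 : L t = 0 by apply: end_zero; rewrite ?at_.
have cCL : C * `|L y| @[y --> within `[a, b] (nbhs t)] --> (0 : R).
  rewrite -(mulr0 C) -(normr0 R) -Lt0; apply: cvgM; first exact: cvg_cst.
  by apply: cvg_norm; apply: cvg_within_filter; exact: cL.
rewrite [X in _ --> X](_ : _ = 0); last by rewrite /from_subspace fctE Lt0 mulr0.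
have cNCL : - (C * `|L y|) @[y --> within `[a, b] (nbhs t)] --> (0 : R).
  by rewrite -[0]oppr0; exact: cvgN.
(* The bound [C * |L y|] also holds at points outside []0, 1[], where [end_zero] makes the product
   vanish. *)
apply: (@squeeze_cvgr _ _ _ _ (fun y => - (C * `|L y|)) (fun y => C * `|L y|) _ _ _ cNCL cCL).
rewrite near_withinE; apply: nearW => y.
rewrite /= in_itv/= => yab; rewrite -ler_norml /from_subspace fctE normrM.
have [y01|/(end_zero _ yab)->] := boolP (0 < y < 1); last by rewrite normr0 !mulr0.
by rewrite ler_wpM2r// uC.
Qed.

(** Here [L t = p + q * t] is one affine piece of the Green function. From [u'' = - f], the function
    [q * u - u' * L] is a primitive of [f * L], and [(f * L)'' = f'' * L + 2 * q * f'] gives the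
    constant. The vanishing of [L] at 0 and 1 controls the primitive where [derive1 u] is junk. *)
Lemma bvp_trapezoid_error (R : realType) (f u : R -> R) (a b p q B : R) :
  0 <= a -> a <= b -> b <= 1 -> C2_in `[0, 1] f -> bvp_solution f u ->
  (a = 0 -> p + q * a = 0) -> (b = 1 -> p + q * b = 0) ->
  (forall t, a <= t <= b -> `|p + q * t| <= B) ->
  `|(q * u b - derive1 u b * (p + q * b))
    - (q * u a - derive1 u a * (p + q * a))
    - (b - a) / 2 * (f a * (p + q * a) + f b * (p + q * b))|
  <= (supnorm01 (derive_in `[0, 1] (derive_in `[0, 1] f)) * B
      + 2 * supnorm01 (derive_in `[0, 1] f) * `|q|) / 12 * (b - a) ^+ 3.
Proof.
move=> a0 ab b1 [df df' cf''] sol La Lb LB.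
set f' := derive_in _ f in df' cf'' *; set f'' := derive_in _ f' in cf'' *.
have cf := derivable_in_within_continuous df.
have cf' := derivable_in_within_continuous df'.
have cu : {within `[0, 1], continuous u} by case: sol.
have sub : `[a, b] `<=` `[0, 1].
  move=> t /=; rewrite !in_itv/= => /andP[at_ tb].
  by rewrite (le_trans a0 at_) (le_trans tb b1).
have in01 t : t \in `]a, b[ -> 0 < t < 1.
  rewrite in_itv/= => /andP[at_ tb].
  by rewrite (le_lt_trans a0 at_) (lt_le_trans tb b1).
pose L : R -> R := cst p + cst q * id.
have dL t : is_derive t (1 : R) L q.
  by apply: is_derive_eq; rewrite /GRing.scale !fctE/=; ring.
have cL (A : set R) : {within A, continuous L} by exact: is_derive_continuous dL.
have cc (A : set R) (c : R) : {within A, continuous (cst c : R -> R)}.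
  by apply: (@is_derive_continuous _ _ _ (cst 0)) => t; exact: is_derive_cst.
have LE t : L t = p + q * t by [].
pose G : R -> R := cst q * u - derive1 u * L.
have cG : {within `[a, b], continuous G}.
  apply: (within_continuousB (within_continuousM (cc _ _) (continuous_subspaceW sub cu))).
  apply: (bvp_solution_derive1M_continuous cf sol) => //.
  by move=> t; exact/differentiable_continuous/derivable1_diffP.
have cfab := continuous_subspaceW sub cf.
have cf'ab := continuous_subspaceW sub cf'.
have dG t : t \in `]a, b[ -> is_derive t (1 : R) G ((f * L) t).
  move=> /in01 t01; have [? ?] := bvp_solution_is_derive sol t01.
  by apply: is_derive_eq; rewrite /GRing.scale !fctE/=; ring.
have dfL t : t \in `]a, b[ -> is_derive t (1 : R) (f * L) ((f' * L + f * cst q) t).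
  move=> /in01 t01; have ? : is_derive t (1 : R) f (f' t) by exact: derivable_in_is_derive.
  by apply: is_derive_eq; rewrite /GRing.scale !fctE/=; ring.
have dfL' t : t \in `]a, b[ -> is_derive t (1 : R) (f' * L + f * cst q)
    ((f'' * L + cst (2 * q) * f') t).
  move=> /in01 t01; have ? : is_derive t (1 : R) f (f' t) by exact: derivable_in_is_derive.
  have ? : is_derive t (1 : R) f' (f'' t) by exact: derivable_in_is_derive.
  by apply: is_derive_eq; rewrite /GRing.scale !fctE/=; ring.
apply: (trapezoid_error ab cG (within_continuousM cfab (cL _))
   (within_continuousD (within_continuousM cf'ab (cL _))
      (within_continuousM cfab (cc _ _))) dG dfL dfL') => t tab.
have t01 : 0 <= t <= 1 by have /andP[t0 t1] := in01 _ tab; rewrite !ltW.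
have f''t := supnorm01_ge cf'' t01; have f't := supnorm01_ge cf' t01.
rewrite !fctE (le_trans (ler_normD _ _))// !normrM lerD//.
  apply: ler_pM => //; apply: LB; move: tab; rewrite in_itv/= => /andP[at_ tb].
  by rewrite !ltW.
by rewrite (@ger0_norm _ 2)// mulrAC ler_wpM2r// ler_wpM2l.
Qed.

(** * Summation by parts and regrouping over the mesh *)

Lemma sum_by_parts (R : comPzRingType) (m : nat) (g d : nat -> R) :
  \sum_(k < m.+1) (g k.+1 - g k) * d k =
  g m.+1 * d m - g 0%N * d 0%N - \sum_(k < m) g k.+1 * (d k.+1 - d k).
Proof.
elim: m => [|m IH]; first by rewrite big_ord_recr !big_ord0/=; ring.
by rewrite big_ord_recr IH [in RHS]big_ord_recr/=; ring.
Qed.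

(** With half steps for [h], the weight gathered at each interior node is the diagonal entry of
    [mass]. *)
Lemma sum_trapezoid_nodes (R : comPzRingType) (m : nat) (h g : nat -> R) :
  \sum_(k < m.+1) h k * (g k + g k.+1) =
  h 0%N * g 0%N + h m * g m.+1 + \sum_(k < m) g k.+1 * (h k + h k.+1).
Proof.
elim: m => [|m IH]; first by rewrite big_ord_recr !big_ord0/=; ring.
by rewrite big_ord_recr IH [in RHS]big_ord_recr/=; ring.
Qed.

(** Each constant-slope block telescopes. The slopes of the Green function, and their absolute
    values, have this two-valued form. *)
Lemma sum_two_slopes (R : comPzRingType) (n i : nat) (r s : R) (w : nat -> R) :
  (i <= n)%N ->
  \sum_(k < n) (if (k < i)%N then r else s) * (w k.+1 - w k) =
  r * (w i - w 0%N) + s * (w n - w i).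
Proof.
move=> lein.
rewrite -(big_mkord xpredT
  (fun k => (if (k < i)%N then r else s) * (w k.+1 - w k))).
rewrite (big_cat_nat (leq0n i) lein)/= -(telescope_sumr _ (leq0n i)).
rewrite -(telescope_sumr _ lein) !big_distrr/=; congr (_ + _).
  by apply: eq_big_nat => k /andP[_ ->].
by apply: eq_big_nat => k /andP[ik _]; rewrite ltnNge ik.
Qed.

(** * Rows of the discrete system *)

(* Entry i of v sits at the node of index i.+1, as in the rows of stiffness. *)
Definition zero_extension (R : realType) (m : nat) (v : 'cV[R]_m) (j : nat) : R :=
  if j is k.+1 then oapp (v^~ ord0) 0 (insub k) else 0.

Lemma zero_extension_inner (R : realType) (m : nat) (v : 'cV[R]_m) (i : 'I_m) :
  zero_extension v i.+1 = v i ord0.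
Proof. by rewrite /zero_extension valK. Qed.

Lemma zero_extension_last (R : realType) (m : nat) (v : 'cV[R]_m) :
  zero_extension v m.+1 = 0.
Proof. by rewrite /zero_extension insubF// ltnn. Qed.

(** The zero boundary values in [V] let the first and last rows follow the same difference formula
    as the others. *)
Lemma stiffness_mulE (R : realType) (m : nat) (x : nat -> R) (v : 'cV[R]_m)
    (i : 'I_m) :
  let V := zero_extension v in
  (stiffness m.+1 x *m v) i ord0 =
  (V i.+1 - V i) / step x i.+1 - (V i.+2 - V i.+1) / step x i.+2.
Proof.
move=> V; rewrite mxE.
(* Split the row into diagonal, superdiagonal and subdiagonal parts, each a sum with at most one
   nonzero term. *)
rewrite (eq_bigr (fun k : 'I_m =>
  (if k == i :> nat then ((step x i.+1)^-1 + (step x i.+2)^-1) * V k.+1 else 0)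
  + (if k == i.+1 :> nat then - (step x i.+2)^-1 * V k.+1 else 0)
  + (if k.+1 == i :> nat then - (step x k.+2)^-1 * V k.+1 else 0))); last first.
  move=> k _; rewrite mxE -zero_extension_inner -/V (eq_sym (i : nat)).
  have [->|ki] := eqVneq (k : nat) i.
    by rewrite (gtn_eqF (ltnSn i)) (ltn_eqF (ltnSn i)) !addr0.
  have [->|ki'] := eqVneq (k : nat) i.+1.
    by rewrite gtn_eqF ?addr0 ?add0r// ltnS.
  by case: eqP => _; rewrite ?add0r ?mul0r.
rewrite !big_split/= -!big_mkcond/=.
rewrite (big_ord1_eq _ (fun k => ((step x i.+1)^-1 + (step x i.+2)^-1) * V k.+1)).
rewrite (big_ord1_eq _ (fun k => - (step x i.+2)^-1 * V k.+1)) ltn_ord.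
(* The last row has no superdiagonal entry, in agreement with [V m.+1 = 0]; below, the first row
   likewise uses [V 0 = 0]. *)
have -> : (if (i.+1 < m)%N then - (step x i.+2)^-1 * V i.+2 else 0)
    = - (step x i.+2)^-1 * V i.+2.
  case: ltnP => // mi; have -> : i.+2 = m.+1 by apply/eqP; rewrite eqSS eqn_leq mi ltn_ord.
  by rewrite /V zero_extension_last mulr0.
have -> : \sum_(k < m | k.+1 == i :> nat) - (step x k.+2)^-1 * V k.+1
    = - (step x i.+1)^-1 * V i.
  case: i => [[|i] im] /=; first by rewrite big_pred0_eq mulr0.
  under eq_bigl do rewrite eqSS.
  by rewrite (big_ord1_eq _ (fun k => - (step x k.+2)^-1 * V k.+1)) (ltnW im).
by rewrite /=; ring.
Qed.

Lemma mass_node_valuesE (R : realType) (n : nat) (x : nat -> R) (f : R -> R)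
    (i : 'I_n.-1) :
  (mass n x *m node_values n x f) i ord0 =
  (step x i.+1 + step x i.+2) / 2 * f (x i.+1).
Proof. by rewrite mul_diag_mx !mxE. Qed.

(** * Monotonicity and width of the mesh *)

Lemma mesh_le (R : realType) (n i j : nat) (x : nat -> R) :
  is_mesh n x -> (i <= j)%N -> (j <= n)%N -> x i <= x j.
Proof.
move=> [_ _ x_lt]; elim: j => [|j IH]; first by rewrite leqn0 => /eqP ->.
rewrite leq_eqVlt => /predU1P[-> //|ij jn].
exact: le_trans (IH ij (ltnW jn)) (ltW (x_lt _ jn)).
Qed.

Lemma step_le_mesh_width (R : realType) (n k : nat) (x : nat -> R) :
  (k < n)%N -> step x k.+1 <= mesh_width n x.
Proof.
move=> kn; apply: le_trans (ler_norm _) _.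
apply: (@le_bigmax_seq _ _ _ _ _ k.+1 xpredT (fun j => `|step x j|)) => //.
by rewrite mem_index_iota.
Qed.

(** * The nodal error bound *)

Theorem theorem3p1 (R : realType) (n : nat) (x : nat -> R) (f u : R -> R)
    (uFD : 'cV[R]_(n.-1)) :
  (2 <= n)%N ->
  is_mesh n x ->
  C2_in `[0, 1] f ->
  bvp_solution f u ->
  stiffness n x *m uFD = mass n x *m node_values n x f ->
  \big[Num.max/0]_(i < n.-1) `|u (x i.+1) - uFD i ord0|
    <= mesh_width n x ^+ 2 / 48 *
       (4 * supnorm01 (derive_in `[0, 1] f)
        + supnorm01 (derive_in `[0, 1] (derive_in `[0, 1] f))).
Proof.
case: n uFD => [//|m] uFD _ mesh C2f sol system.
have [df df' cf''] := C2f; have [x0 xn x_lt] := mesh.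
have := supnorm01_ge cf'' (t := 0); rewrite lexx ler01 => /(_ isT).
have := supnorm01_ge (derivable_in_within_continuous df') (t := 0).
rewrite lexx ler01 => /(_ isT).
have := @bvp_trapezoid_error R f u _ _ _ _ _ _ _ _ C2f sol.
set M1 := supnorm01 (derive_in _ f); set M2 := supnorm01 _.
move=> local_error /(le_trans (normr_ge0 _)) M1_ge0 /(le_trans (normr_ge0 _)) M2_ge0.
set h := mesh_width _ x.
have step_gt0 k : (k < m.+1)%N -> 0 < step x k.+1 by move=> km; rewrite subr_gt0 x_lt.
have h_ge0 : 0 <= h :=
  le_trans (ltW (step_gt0 0%N isT)) (step_le_mesh_width x (ltn0Sn m)).
apply: bigmax_le => [|i _].
  by rewrite mulr_ge0 ?divr_ge0 ?exprn_ge0 ?addr_ge0 ?mulr_ge0.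
set V := zero_extension uFD.
rewrite -zero_extension_inner -/V.
set I := i.+1; set z := x I.
have Im : (I <= m.+1)%N by rewrite ltnW// ltnS ltn_ord.
have z0 : 0 <= z by rewrite -x0 (mesh_le mesh).
have z1 : z <= 1 by rewrite -xn (mesh_le mesh).
(* On [[x k, x k.+1]] the Green function with pole [z] is [p k + s k * t]; [g] lists its nodal
   values, and its slope drops by 1 at [z]. *)
pose s (k : nat) : R := if (k < I)%N then 1 - z else - z.
pose p (k : nat) : R := if (k < I)%N then 0 else z.
pose g (k : nat) : R := if (k <= I)%N then (1 - z) * x k else z * (1 - x k).
have gl k : p k + s k * x k = g k.
  rewrite /p /s /g; case: ltngtP => [kI|kI|->]; last by rewrite -/z; ring.
    by ring.
  by ring.
have gr k : p k + s k * x k.+1 = g k.+1.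
  by rewrite /p /s /g; case: ltnP => kI; ring.
have g0 : g 0%N = 0 by rewrite /g x0 mulr0.
have gn : g m.+1 = 0.
  rewrite /g; case: (leqP m.+1 I) => mI; last by rewrite xn subrr mulr0.
  have -> : z = 1 by rewrite -xn /z; congr x; apply/eqP; rewrite eqn_leq Im.
  by rewrite subrr mul0r.
have V0 : V 0%N = 0 by [].
have Vn : V m.+1 = 0 by rewrite /V zero_extension_last.
have [_ _ u0 u1] := sol.
(* The two slopes give [(1 - z) * u z + z * u z], as [u] vanishes at both ends. *)
have u_rep : u z = \sum_(k < m.+1) s k * (u (x k.+1) - u (x k)).
  by rewrite (sum_two_slopes _ _ (fun k => u (x k)) Im) x0 xn u0 u1 -/z; ring.
have V_rep : V I = \sum_(k < m.+1) step x k.+1 / 2 *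
    (g k * f (x k) + g k.+1 * f (x k.+1)).
  rewrite (sum_trapezoid_nodes m (fun k => step x k.+1 / 2) (fun k => g k * f (x k))).
  rewrite g0 gn !mul0r !mulr0 !add0r.
  (* Represent [V I] in the same way, then sum by parts to move the differences from [g] to the
     fluxes of [V]; row [k] of the system turns each flux jump into a mass term. *)
  transitivity (\sum_(k < m.+1) s k * (V k.+1 - V k)).
    by rewrite (sum_two_slopes _ _ V Im) V0 Vn; ring.
  transitivity (\sum_(k < m.+1) (g k.+1 - g k) * ((V k.+1 - V k) / step x k.+1)).
    apply: eq_bigr => k _; rewrite -(gr k) -(gl k).
    have := step_gt0 _ (ltn_ord k); rewrite /step/= => /gt_eqF d0.
    by field; rewrite d0.
  rewrite (sum_by_parts m g (fun k => (V k.+1 - V k) / step x k.+1)).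
  rewrite g0 gn !mul0r subrr sub0r -sumrN; apply: eq_bigr => k _.
  have := congr1 (fun v : 'cV[R]_m => v k ord0) system.
  rewrite stiffness_mulE (@mass_node_valuesE _ m.+1) -/V => E.
  by rewrite -mulrN opprB E; field.
(* Adding this zero sum completes each [s k * u] increment to an increment of the primitive of [f]
   times the Green function. The factor [g] cancels the junk values of [derive1 u] at 0 and 1. *)
have flux : \sum_(k < m.+1)
    (derive1 u (x k.+1) * g k.+1 - derive1 u (x k) * g k) = 0.
  rewrite -(big_mkord xpredT (fun k => derive1 u (x k.+1) * g k.+1 - derive1 u (x k) * g k)).
  by rewrite telescope_sumr// g0 gn !mulr0 subrr.
rewrite u_rep V_rep -[X in X - _]subr0 -[X in _ - X - _]flux -!sumrB.
pose S k := if (k < I)%N then 1 - z else z.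
have S_ge0 k : 0 <= S k by rewrite /S; case: ifP => _ //; rewrite subr_ge0.
have Ss k : `|s k| = S k.
  by rewrite /s /S; case: ifP => _; rewrite ?normrN ger0_norm// subr_ge0.
(* Bound the cubed step by [h ^+ 2] times the step, keeping one factor so that the steps sum to 1
   and the terms in [S] to the total variation of the Green function. *)
apply: (@le_trans _ _ (\sum_(k < m.+1) h ^+ 2 / 12 *
    (M2 / 4 * (x k.+1 - x k) + 2 * M1 * (S k * (x k.+1 - x k))))).
  apply: le_trans (ler_norm_sum _ _ _) _; apply: ler_sum => k _.
  have xk0 : 0 <= x k by rewrite -x0 (mesh_le mesh)// ltnW.
  have xk1 : x k.+1 <= 1 by rewrite -xn (mesh_le mesh).
  have xk : x k <= x k.+1 by rewrite ltW// x_lt.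
  have gk_bound t : x k <= t <= x k.+1 -> `|p k + s k * t| <= 1 / 4.
    move=> /andP[kt tk]; have t0 := le_trans xk0 kt; have t1 := le_trans tk xk1.
    (* The Green function peaks at its pole, with value [z * (1 - z)]. *)
    have sq : (1 - z) * z <= 1 / 4 by have := sqr_ge0 (z - 1 / 2); lra.
    rewrite /p /s; case: ltnP => kI.
      have tz : t <= z by apply: le_trans tk _; rewrite (mesh_le mesh).
      rewrite add0r ger0_norm ?mulr_ge0 ?subr_ge0//.
      by apply: le_trans sq; rewrite ler_wpM2l ?subr_ge0.
    have zt : z <= t by apply: le_trans kt; rewrite (mesh_le mesh)// ltnW.
    have -> : z + - z * t = z * (1 - t) by ring.
    rewrite ger0_norm ?mulr_ge0 ?subr_ge0//.
    by apply: le_trans sq; rewrite mulrC ler_wpM2r// lerB.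
  (* By strict monotonicity only node 0 sits at 0, and below only the last node sits at 1; [g]
     vanishes at both. *)
  have La : x k = 0 -> p k + s k * x k = 0.
    case: (posnP k) => [->|k0]; first by rewrite gl g0.
    have := lt_le_trans (x_lt 0%N isT) (mesh_le mesh k0 (ltnW (ltn_ord k))).
    by rewrite x0 => + xk00; rewrite xk00 ltxx.
  have Lb : x k.+1 = 1 -> p k + s k * x k.+1 = 0.
    have := ltn_ord k; rewrite ltnS leq_eqVlt => /predU1P[->|km].
      by rewrite gr gn.
    have := mesh_le mesh (km : (k.+1 < m.+1)%N) (leqnn _).
    move=> /(lt_le_trans (x_lt k.+1 km)).
    by rewrite xn => + xk11; rewrite xk11 ltxx.
  have := local_error _ _ _ _ _ xk0 xk xk1 La Lb gk_bound.
  rewrite gl gr Ss => err; set lhs := (X in `|X|).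
  have -> : lhs = s k * u (x k.+1) - derive1 u (x k.+1) * g k.+1
      - (s k * u (x k) - derive1 u (x k) * g k)
      - (x k.+1 - x k) / 2 * (f (x k) * g k + f (x k.+1) * g k.+1).
    by rewrite /lhs /step; ring.
  apply: le_trans err _.
  have -> : (M2 * (1 / 4) + 2 * M1 * S k) / 12 * (x k.+1 - x k) ^+ 3 =
      (x k.+1 - x k) ^+ 2 * (1 / 12 * ((M2 / 4 + 2 * M1 * S k) * (x k.+1 - x k))).
    by field.
  have -> : h ^+ 2 / 12 * (M2 / 4 * (x k.+1 - x k) + 2 * M1 * (S k * (x k.+1 - x k)))
     = h ^+ 2 * (1 / 12 * ((M2 / 4 + 2 * M1 * S k) * (x k.+1 - x k))) by field.
  apply: ler_wpM2r.
    rewrite mulr_ge0// ?divr_ge0// mulr_ge0 ?subr_ge0// addr_ge0 ?divr_ge0//.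
    by rewrite !mulr_ge0.
  by rewrite ler_pXn2r ?nnegrE ?subr_ge0// step_le_mesh_width.
rewrite -mulr_sumr big_split/= -!mulr_sumr (sum_two_slopes _ _ x Im).
rewrite -(big_mkord xpredT (fun k => x k.+1 - x k)) telescope_sumr// x0 xn -/z.
have -> : h ^+ 2 / 48 * (4 * M1 + M2) = h ^+ 2 / 12 * (M1 + M2 / 4) by field.
apply: ler_wpM2l; first by rewrite divr_ge0 ?exprn_ge0.
(* The total variation is [2 * z * (1 - z)], so the claim reduces to [4 * z * (1 - z) <= 1], that
   is, [0 <= (2 * z - 1) ^+ 2], weighted by [M1]. *)
have := mulr_ge0 M1_ge0 (sqr_ge0 (2 * z - 1)).
by rewrite !expr2; lra.
Qed.
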